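(* For every integer $r\ge 1$, let $P_r=\Phi^+(B_r)$ be the positive-root poset of type $B_r$ graded by $\operatorname{rk}(\alpha)=\operatorname{ht}(\alpha)-1$. Then $$\mathbb{H}_{P_r,\operatorname{rk}}(q,t)=\sum_{w\in\mathcal B_r}q^{\sum_{j\in D(w)}(j-1)}\,t^{|D(w)|}.$$ In particular, every coefficient of the $q$-Zeta numerator $\mathbb{H}_{P_r,\operatorname{rk}}(q,t)$ is a nonnegative integer.
   Context: $q$-Zeta numerator: let $P$ be a finite graded poset with a unique maximum and rank function $\rho:P\to\{0,\dots,H\}$, where $H$ is the maximal rank. For $m\ge 0$ put $A_m(P,\rho;q)=\sum_{x_1\le\cdots\le x_m}q^{\rho(x_1)+\cdots+\rho(x_m)}$ (sum over weak chains in $P$; $A_0=1$). The numerator $\mathbb{H}_{P,\rho}(q,t)$ is the polynomial determined by $\sum_{m\ge 0}A_m(P,\rho;q)t^m=\mathbb{H}_{P,\rho}(q,t)/\prod_{a=0}^{H}(1-q^at)$. Type $B_r$ in $\mathbb{R}^r$ with standard basis $e_1,\dots,e_r$: simple roots $\alpha_i=e_i-e_{i+1}$ ($1\le i<r$), $\alpha_r=e_r$; positive roots $e_i-e_j$ ($i<j$), $e_i$, $e_i+e_j$ ($i<j$). Order: $\alpha\le\beta$ iff $\beta-\alpha$ is a nonnegative integer combination of simple roots. The height $\operatorname{ht}(\alpha)$ is the sum of the simple-root coefficients of $\alpha$. Words: a word in $\{L,R\}$ is a ballot word if every prefix contains at least as many $R$'s as $L$'s. $\mathcal B_r$ is the set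 of words $w\in\{L,R\}^{2r-2}$ whose reversal is a ballot word (for $r=1$, only the empty word). For $w=w_1\cdots w_m$, $D(w)=\{j: w_j=L\text{ and }(j=1\text{ or }w_{j-1}=R)\}$. *)

(* Defs.v *)
From HB Require Import structures.
From mathcomp Require Import all_boot all_order all_algebra.
From mathcomp Require Import boolp.

Set Implicit Arguments.
Unset Strict Implicit.
Unset Printing Implicit Defensive.

Import Order.TTheory GRing.Theory Num.Theory.

Local Open Scope ring_scope.

(* Polynomials in q are elements of {poly int}; polynomials in q and t are
   elements of {poly {poly int}}, the outer variable being t.                *)

Definition qzeta_A (d : Order.disp_t) (P : finPOrderType d) (rho : P -> nat)
    (m : nat) : {poly int} :=
  \sum_(x : m.-tuple P | sorted <=%O x) 'X^(\sum_(i < m) rho (tnth x i)).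

Definition max_rank (d : Order.disp_t) (P : finPOrderType d) (rho : P -> nat)
    : nat :=
  \max_(x : P) rho x.

Definition qzeta_denominator (d : Order.disp_t) (P : finPOrderType d)
    (rho : P -> nat) : {poly {poly int}} :=
  \prod_(a < (max_rank rho).+1) (1 - ('X^a)%:P * 'X).

(* The identity sum_m A_m t^m = N / prod_a (1 - q^a t) of power series in t
   over Z[q], with the denominator (which has constant term 1) cleared and
   coefficients of t^n compared.                                             *)
Definition is_qzeta_numerator (d : Order.disp_t) (P : finPOrderType d)
    (rho : P -> nat) (N : {poly {poly int}}) : Prop :=
  forall n : nat,
    \sum_(i < n.+1) qzeta_A rho i * (qzeta_denominator rho)`_(n - i) = N`_n.

(* The roots of B_r have integer coordinates, so they are taken in Z^r;
   coordinates are numbered from 0.                                          *)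
Definition stdvec (r : nat) (i : 'I_r) : 'rV[int]_r := delta_mx 0 i.

Definition simple_root (r : nat) (i : 'I_r) : 'rV[int]_r :=
  if insub i.+1 is Some j then stdvec i - stdvec j else stdvec i.

Definition positive_roots (r : nat) : seq 'rV[int]_r :=
  [seq stdvec p.1 - stdvec p.2 |
     p : 'I_r * 'I_r <- enum {: 'I_r * 'I_r} & (p.1 < p.2)%N]
  ++ [seq stdvec i | i <- enum 'I_r]
  ++ [seq stdvec p.1 + stdvec p.2 |
     p : 'I_r * 'I_r <- enum {: 'I_r * 'I_r} & (p.1 < p.2)%N].

Definition posrootB (r : nat) : Type := seq_sub (positive_roots r).

HB.instance Definition _ (r : nat) := Finite.on (posrootB r).

Definition rootB_le (r : nat) (a b : posrootB r) : bool :=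
  `[< exists c : 'I_r -> nat,
        val b - val a = \sum_(i < r) simple_root i *+ c i >].

(* The rows of this matrix are a basis of Z^r (simple_root_mx_unit), so
   simple_coeffs v is the vector of coordinates of v on the simple roots.    *)
Definition simple_root_mx (r : nat) : 'M[int]_r :=
  \matrix_(i < r) simple_root i.

Definition simple_coeffs (r : nat) (v : 'rV[int]_r) : 'rV[int]_r :=
  v *m invmx (simple_root_mx r).

Definition height (r : nat) (v : 'rV[int]_r) : int :=
  \sum_(i < r) simple_coeffs v 0 i.

Lemma simple_rootE (r : nat) (i j : 'I_r) :
  simple_root i 0 j = (j == i)%:R - (j == i.+1 :> nat)%:R.
Proof.
rewrite /simple_root; case: insubP => [k _ Ek|].
  by rewrite !mxE eqxx /= -val_eqE /= -Ek.
rewrite -leqNgt => ler; rewrite !mxE eqxx /=.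
by rewrite (ltn_eqF (leq_trans (ltn_ord j) ler)) subr0.
Qed.

Lemma simple_root_mx_unit (r : nat) : simple_root_mx r \in unitmx.
Proof.
rewrite unitmxE -det_tr det_trig; last first.
  apply/is_trig_mxP => i j ltij; rewrite !mxE simple_rootE -val_eqE /=.
  by rewrite (ltn_eqF ltij) (ltn_eqF (leqW ltij)) subrr.
rewrite big1 ?unitr1 // => i _; rewrite !mxE simple_rootE eqxx.
by rewrite (ltn_eqF (ltnSn i)) subr0.
Qed.

Lemma simple_coeffsP (r : nat) (v : 'rV[int]_r) :
  v = \sum_(i < r) simple_coeffs v 0 i *: simple_root i.
Proof.
rewrite -[LHS](mulmxKV (simple_root_mx_unit r)) mulmx_sum_row.
by apply: eq_bigr => i _; rewrite rowK.
Qed.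

Lemma heightD (r : nat) : {morph @height r : u v / u + v}.
Proof.
move=> u v; rewrite /height -big_split; apply: eq_bigr => i _.
by rewrite /simple_coeffs mulmxDl mxE.
Qed.

Lemma heightN (r : nat) : {morph @height r : u / - u}.
Proof.
move=> u; rewrite /height -sumrN; apply: eq_bigr => i _.
by rewrite /simple_coeffs mulNmx mxE.
Qed.

Lemma height_comb (r : nat) (c : 'I_r -> nat) :
  height (\sum_(i < r) simple_root i *+ c i) = (\sum_(i < r) c i)%:R.
Proof.
have -> : \sum_(i < r) simple_root i *+ c i
          = (\row_i (c i)%:R) *m simple_root_mx r.
  rewrite mulmx_sum_row; apply: eq_bigr => i _.
  by rewrite rowK mxE scaler_nat.
rewrite /height /simple_coeffs mulmxK ?simple_root_mx_unit // natr_sum.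
by apply: eq_bigr => i _; rewrite mxE.
Qed.

Lemma height_simple (r : nat) (i : 'I_r) : height (simple_root i) = 1.
Proof.
have -> : simple_root i = \sum_(j < r) simple_root j *+ (j == i).
  by rewrite (bigD1 i) //= eqxx big1 ?addr0 // => j /negPf->.
rewrite height_comb (bigD1 i) //= eqxx big1 // => j /negPf->.
by [].
Qed.

Lemma height_stdvec (r : nat) (i : 'I_r) : height (stdvec i) = (r - i)%:R.
Proof.
have [n] := ubnP (r - i); elim: n i => // n IHn i; rewrite ltnS => len.
have := height_simple i; rewrite /simple_root; case: insubP => [j ltj Ej|].
  have rSj : (r - i = (r - j).+1)%N by rewrite Ej /= subnSK.
  rewrite heightD heightN (IHn j); last by rewrite rSj in len.
  move=> /eqP.
  by rewrite subr_eq rSj -natr1 addrC => /eqP.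
rewrite -leqNgt => ler ->.
by have /eqP-> : (r - i == 1)%N by rewrite eqn_leq leq_subLR addn1 ler
  subn_gt0 /=.
Qed.

Lemma height_gt0 (r : nat) (a : posrootB r) : 0 < height (val a).
Proof.
have := valP a; rewrite /positive_roots !mem_cat => /or3P[] /mapP[x].
- rewrite mem_filter => /andP[ltx _] ->.
  rewrite heightD heightN !height_stdvec subr_gt0 ltr_nat.
  by rewrite ltn_sub2l.
- by move=> _ ->; rewrite height_stdvec ltr0n subn_gt0.
- move=> _ ->; rewrite heightD !height_stdvec -natrD ltr0n.
  by rewrite addn_gt0 subn_gt0 ltn_ord.
Qed.

Fact rootB_le_refl (r : nat) : reflexive (@rootB_le r).
Proof.
move=> a; apply/asboolP; exists (fun=> 0%N).
by rewrite subrr big1 // => i _; rewrite mulr0n.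
Qed.

Fact rootB_le_anti (r : nat) : antisymmetric (@rootB_le r).
Proof.
move=> a b /andP[/asboolP[c Ec] /asboolP[d Ed]]; apply/val_inj/eqP.
have c0 : (\sum_(i < r) c i + \sum_(i < r) d i)%N = 0%N.
  apply/eqP; rewrite -(eqr_nat int) natrD -!height_comb -Ec -Ed.
  by rewrite -heightD addrA subrK subrr -[0](subrr 0) heightD heightN subrr.
move: c0 => /eqP; rewrite addn_eq0 => /andP[/eqP c0 _].
rewrite eq_sym -subr_eq0 Ec big1 // => i _.
have /eqP := c0; rewrite sum_nat_eq0 => /forallP/(_ i)/eqP->.
exact: mulr0n.
Qed.

Fact rootB_le_trans (r : nat) : transitive (@rootB_le r).
Proof.
move=> b a e /asboolP[c Ec] /asboolP[d Ed]; apply/asboolP.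
exists (fun i => d i + c i)%N.
under eq_bigr do rewrite mulrnDr.
by rewrite big_split /= -Ec -Ed addrA subrK.
Qed.

HB.instance Definition _ (r : nat) :=
  Order.Le_isPOrder.Build (Order.Disp tt tt) (posrootB r)
    (@rootB_le_refl r) (@rootB_le_anti r) (@rootB_le_trans r).

Lemma rootB_leP (r : nat) (a b : posrootB r) :
  reflect (exists c : 'I_r -> nat,
             val b - val a = \sum_(i < r) simple_root i *+ c i)
          (a <= b)%O.
Proof. exact: asboolP. Qed.

(* ht(a) - 1 as a natural number; the absolute value only serves as the
   conversion from int to nat, see rootB_rankE.                              *)
Definition rootB_rank (r : nat) (a : posrootB r) : nat :=
  `|height (val a) - 1|%N.

Lemma rootB_rankE (r : nat) (a : posrootB r) :
  (rootB_rank a)%:Z = height (val a) - 1.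
Proof. by rewrite /rootB_rank gez0_abs // subr_ge0 -gtz0_ge1 height_gt0. Qed.

Notation letter := bool (only parsing).
Definition letterL : letter := false.
Definition letterR : letter := true.

Definition ballot (w : seq letter) : bool :=
  [forall k : 'I_(size w).+1,
     count_mem letterL (take k w) <= count_mem letterR (take k w)]%N.

Definition ballotB (r : nat) : {set (2 * r - 2).-tuple letter} :=
  [set w : (2 * r - 2).-tuple letter | ballot (rev w)].

(* Positions in words are numbered from 1, so w_j is nth _ w j.-1.           *)
Definition wordD (w : seq letter) : seq nat :=
  [seq j <- iota 1 (size w) |
     (nth letterR w j.-1 == letterL)
     && ((j == 1%N) || (nth letterL w j.-2 == letterR))].

(* Main.v *)
Require Import Defs.
From mathcomp Require Import all_boot all_order all_algebra.
From mathcomp Require Import boolp zify ring.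

(* In the coordinates e_x + e_(y+1), with e_r = 0 and e_(2r-k) = - e_k, the
   positive roots form the trapezoid 0 <= x <= y, x + y <= H = 2r - 2, with
   the reversed product order and rank h = H - x - y.  Let Z(x, y) be the
   generating series of the multichains below (x, y).  Removing the
   multichains with largest element (x, y), inclusion-exclusion gives
     Z(x, y) (1 - q^h t) = Z(x+1, y) + Z(x, y+1) - Z(x+1, y+1)
   (the terms at x+1 cancel when x = y).  Words with ballot reversal are the
   saturated chains from rank 0 up to the maximum, and D(w) marks the vertices
   at which an R (or the start) is followed by an L.  Splitting the words that
   lead to (x, y) by their last letter, their weight sum N(x, y) satisfies
     N(x, y) = N(x+1, y) + N(x, y+1) - (1 - q^(h-1) t) N(x+1, y+1),
   because the last L is marked exactly when an R (or the start) precedes it.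
   This is the recursion obtained from the one for Z by clearing
   denominators. *)

Set Implicit Arguments.
Unset Strict Implicit.
Unset Printing Implicit Defensive.

Import Order.TTheory GRing.Theory Num.Theory.
Local Open Scope ring_scope.

(** * Reindexing sums over tuples *)

Lemma big_tuple_cons (T : finType) (R : Type) (idx : R)
    (op : Monoid.com_law idx) (n : nat) (P : pred (seq T)) (F : seq T -> R) :
  \big[op/idx]_(t : n.+1.-tuple T | P t) F t =
  \big[op/idx]_(x : T) \big[op/idx]_(s : n.-tuple T | P (x :: s)) F (x :: s).
Proof.
rewrite pair_big_dep /=.
rewrite (reindex (fun p : T * n.-tuple T => [tuple of p.1 :: p.2])) //=.
exists (fun t : n.+1.-tuple T => (thead t, [tuple of behead t])).
- move=> [x s] _ /=; rewrite theadE; congr pair; exact: val_inj.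
- by move=> t _; rewrite [RHS]tuple_eta.
Qed.

Lemma big_tuple_rev (T : finType) (R : Type) (idx : R)
    (op : Monoid.com_law idx) (n : nat) (P : pred (seq T)) (F : seq T -> R) :
  \big[op/idx]_(t : n.-tuple T | P t) F t =
  \big[op/idx]_(t : n.-tuple T | P (rev t)) F (rev t).
Proof.
rewrite (reindex (fun t : n.-tuple T => [tuple of rev t])) //=.
by exists (fun t : n.-tuple T => [tuple of rev t]) => t _;
  apply: val_inj; rewrite /= revK.
Qed.

(** * Clearing denominators of power series *)

(* As power series in t, D * (sum_m u m t^m) = N. *)
Definition clears (R : comNzRingType) (u : nat -> R) (D N : {poly R}) : Prop :=
  forall n : nat, \sum_(i < n.+1) u i * D`_(n - i) = N`_n.

Lemma eq_clears (R : comNzRingType) (u v : nat -> R) (D N : {poly R}) :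
  u =1 v -> clears u D N -> clears v D N.
Proof. by move=> uv uN n; rewrite -uN; apply: eq_bigr => i _; rewrite uv. Qed.

Lemma clearsD (R : comNzRingType) (u v : nat -> R) (D M N : {poly R}) :
  clears u D M -> clears v D N -> clears (fun m => u m + v m) D (M + N).
Proof.
move=> uM vN n; rewrite coefD -uM -vN -big_split.
by apply: eq_bigr => i _; rewrite mulrDl.
Qed.

Lemma clearsB (R : comNzRingType) (u v : nat -> R) (D M N : {poly R}) :
  clears u D M -> clears v D N -> clears (fun m => u m - v m) D (M - N).
Proof.
move=> uM vN n; rewrite coefB -uM -vN -sumrB.
by apply: eq_bigr => i _; rewrite mulrBl.
Qed.

Lemma coefM_linear (R : comNzRingType) (c : R) (D : {poly R}) (n : nat) :
  (D * (1 - c%:P * 'X))`_n = D`_n - (if n is k.+1 then c * D`_k else 0).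
Proof.
rewrite mulrBr mulr1 coefB [c%:P * _]mulrC mulrA coefMC coefMX.
by case: n => [|n] /=; rewrite ?mul0r // mulrC.
Qed.

Lemma conv_linear (R : comNzRingType) (u : nat -> R) (c : R) (D : {poly R})
    (n : nat) :
  \sum_(i < n.+1) u i * (D * (1 - c%:P * 'X))`_(n - i) =
  \sum_(i < n.+1) u i * D`_(n - i) -
  (if n is k.+1 then c * \sum_(i < k.+1) u i * D`_(k - i) else 0).
Proof.
under eq_bigr do rewrite coefM_linear mulrBr.
rewrite sumrB; congr (_ - _); case: n => [|n].
  by rewrite big_ord1 mulr0.
rewrite big_ord_recr /= subnn mulr0 addr0 big_distrr.
by apply: eq_bigr => i _; rewrite subSn 1?mulrCA // -ltnS.
Qed.

Lemma clearsMr (R : comNzRingType) (u : nat -> R) (c : R) (D N : {poly R}) :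
  clears u D N -> clears u (D * (1 - c%:P * 'X)) (N * (1 - c%:P * 'X)).
Proof.
move=> uN n; rewrite conv_linear coefM_linear uN.
by case: n => // n; rewrite uN.
Qed.

(** The hypotheses on [v] say that its series is [1 - c t] times the series of [u]. *)
Lemma clearsMl (R : comNzRingType) (u v : nat -> R) (c : R) (D N : {poly R}) :
  v 0%N = u 0%N -> (forall m, v m.+1 = u m.+1 - c * u m) ->
  clears v D N -> clears u (D * (1 - c%:P * 'X)) N.
Proof.
move=> v0 vS vN n; rewrite conv_linear -vN; case: n => [|n].
  by rewrite !big_ord1 v0 subr0.
rewrite big_ord_recl [in RHS]big_ord_recl /= v0 -addrA; congr (_ + _).
rewrite big_distrr -sumrB; apply: eq_bigr => i _.
by rewrite /bump /= add1n vS subSS mulrBl mulrA.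
Qed.

Lemma clears1 (R : comNzRingType) : clears (fun m => (m == 0%N)%:R : R) 1 1.
Proof.
move=> n; rewrite big_ord_recl /= mul1r subn0 big1 ?addr0 // => i _.
by rewrite /bump /= mul0r.
Qed.

(** * Weights of words and their ballot sums *)

Definition word_weight (w : seq bool) : {poly {poly int}} :=
  ('X^(\sum_(j <- wordD w) (j - 1)))%:P * 'X^(size (wordD w)).

(** The default [letterR] of [last] makes the empty word count as ending in R, which is the clause
    [j = 1] of [wordD]. *)
Lemma wordD_rcons (w : seq bool) (a : bool) :
  wordD (rcons w a) =
  if ~~ a && last letterR w then rcons (wordD w) (size w).+1 else wordD w.
Proof.
have -> : wordD w = [seq j <- iota 1 (size w) |
     (nth letterR (rcons w a) j.-1 == letterL)
     && ((j == 1%N) || (nth letterL (rcons w a) j.-2 == letterR))].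
  apply: eq_in_filter => -[|j]; rewrite mem_iota //= add1n ltnS => ltj.
  rewrite !nth_rcons ltj; congr (_ && _); case: j ltj => //= j ltj.
  by rewrite (ltnW ltj).
rewrite /wordD size_rcons -[in iota 1 _](addn1 (size w)) iotaD cats1.
rewrite filter_rcons.
set D := filter _ _; rewrite add1n /= nth_rcons ltnn eqxx.
case: a @D => D //=; case/lastP: w @D => [|w b] D //=.
rewrite last_rcons size_rcons /= !nth_rcons size_rcons ltnS leqnn ltnn eqxx.
by case: b @D.
Qed.

Lemma word_weight_rcons (w : seq bool) (a : bool) :
  word_weight (rcons w a) =
  word_weight w *
  (if ~~ a && last letterR w then ('X^(size w))%:P * 'X else 1).
Proof.
rewrite /word_weight wordD_rcons; case: ifP => _; last by rewrite mulr1.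
rewrite size_rcons -cats1 big_cat big_seq1 subSS subn0 exprD polyCM exprSr.
by ring.
Qed.

(** Here [d] is the surplus of R's over L's already read. *)
Fixpoint ballot_from (d : nat) (s : seq bool) : bool :=
  match s with
  | [::] => true
  | true :: s' => ballot_from d.+1 s'
  | false :: s' => if d is d'.+1 then ballot_from d' s' else false
  end.

Lemma ballot_fromP (d : nat) (s : seq bool) :
  reflect (forall k, (count_mem letterL (take k s) <=
                      d + count_mem letterR (take k s))%N)
          (ballot_from d s).
Proof.
elim: s d => [|[] s IHs] d /=; first by apply: ReflectT.
- apply: (iffP (IHs _)) => [leLR [|k] //=|leLR k].
    by rewrite addnS -addSn leLR.
  by have := leLR k.+1; rewrite /= addnS.
- case: d => [|d].
    by apply: ReflectF => /(_ 1%N); rewrite /= take0.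
  apply: (iffP (IHs _)) => [leLR [|k] //=|leLR k]; first exact: leLR.
  exact: (leLR k.+1).
Qed.

Lemma ballotE (s : seq bool) : ballot s = ballot_from 0 s.
Proof.
apply/forallP/ballot_fromP => [leLR k|leLR k]; last exact: leLR.
have [ltk|gek] := ltnP k (size s).+1; first exact: (leLR (Ordinal ltk)).
by have := leLR ord_max; rewrite /= take_size take_oversize // ltnW.
Qed.

(** This is N(x, y) for a point of rank [h] with [d = y - x]: [s] reads the word backwards, hence
    the chain downwards from (x, y), an R raising y and an L raising x. *)
Definition ballot_sum (h d : nat) : {poly {poly int}} :=
  \sum_(s : h.-tuple bool | ballot_from d s) word_weight (rev s).

Lemma ballot_sum0 (d : nat) : ballot_sum 0 d = 1.
Proof.
rewrite /ballot_sum (eq_bigl (pred1 [tuple])); last by move=> t; rewrite tuple0.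
by rewrite big_pred1_eq /word_weight /= big_nil !expr0 mulr1.
Qed.

(* Peeling off the last letter of the word, i.e. the head of its reversal. *)
Lemma ballot_sumS (h d : nat) :
  ballot_sum h.+1 d =
  ballot_sum h d.+1 +
  (if d is d'.+1 then
     \sum_(s : h.-tuple bool | ballot_from d' s) word_weight (rev s) *
        (if last letterR (rev s) then ('X^h)%:P * 'X else 1)
   else 0).
Proof.
rewrite /ballot_sum.
rewrite (big_tuple_cons _ _ (ballot_from d) (fun s => word_weight (rev s))).
rewrite big_bool /=; congr (_ + _).
  by apply: eq_bigr => s _; rewrite rev_cons word_weight_rcons mulr1.
case: d => [|d]; first by rewrite big_pred0.
apply: eq_bigr => s _.
by rewrite rev_cons word_weight_rcons size_rev size_tuple.
Qed.

Lemma ballot_sumS0 (h : nat) : ballot_sum h.+1 0 = ballot_sum h 1.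
Proof. by rewrite ballot_sumS addr0. Qed.

(* The value at h = 0 accounts for points below rank 0, under which the only
   multichain is the empty one. *)
Definition ballot_sum_pred (h d : nat) : {poly {poly int}} :=
  if h is h'.+1 then ballot_sum h' d else 1.

Lemma ballot_sumSS (h d : nat) :
  ballot_sum h.+1 d.+1 =
  ballot_sum h d + ballot_sum h d.+2
  - ballot_sum_pred h d.+1 * (1 - ('X^h)%:P * 'X).
Proof.
rewrite ballot_sumS addrC -addrA [ballot_sum h d.+2 - _]addrC addrA.
(* Words ending in L remain. Compared with [ballot_sum h d], the final L replaces the factor 1 by
   [q^h t] on the prefixes that are empty or end in R. These prefixes sum to
   [ballot_sum_pred h d.+1], because a final R carries no weight. *)
congr (_ + _); case: h => [|h] /=.
  rewrite ballot_sum0 (eq_bigl (pred1 [tuple])); last first.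
    by move=> t; rewrite tuple0.
  rewrite big_pred1_eq /word_weight /= big_nil !expr0; ring.
rewrite /ballot_sum.
rewrite (big_tuple_cons _ _ (ballot_from d) (fun s => word_weight (rev s))).
rewrite (big_tuple_cons _ _ (ballot_from d) (fun s => word_weight (rev s) *
   (if last letterR (rev s) then ('X^(h.+1))%:P * 'X else 1))).
rewrite !big_bool /=.
under eq_bigr do rewrite rev_cons last_rcons word_weight_rcons mulr1.
under [X in _ + X]eq_bigr do rewrite rev_cons last_rcons mulr1.
under [X in _ = X + _ - _]eq_bigr do rewrite rev_cons word_weight_rcons mulr1.
under [X in _ = _ + X - _]eq_bigr do rewrite rev_cons.
rewrite -big_distrl /=; ring.
Qed.

(** * Multichains in a trapezoid *)

(* The order is reversed: the maximum of [P] sits at the origin. *)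
Record trapezoid_chart (d : Order.disp_t) (P : finPOrderType d)
    (rho X Y : P -> nat) (H : nat) : Prop := TrapezoidChart {
  chart_le : forall a b, (a <= b)%O = (X b <= X a)%N && (Y b <= Y a)%N;
  chart_leXY : forall a, (X a <= Y a)%N;
  chart_rank : forall a, (rho a + (X a + Y a) = H)%N;
  chart_onto : forall x y, (x <= y)%N -> (x + y <= H)%N ->
    exists a, X a = x /\ Y a = y
}.

(** Multichains are listed from the largest element down. The bound is a pair of numbers rather than
    an element, so that recursions may step outside the trapezoid. *)
Fixpoint zeta_cone (T : finType) (rho X Y : T -> nat) (m x y : nat)
    : {poly int} :=
  if m is m'.+1 then
    \sum_(a | (x <= X a)%N && (y <= Y a)%N)
       'X^(rho a) * zeta_cone rho X Y m' (X a) (Y a)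
  else 1.

Lemma max_rank_chart (d : Order.disp_t) (P : finPOrderType d)
    (rho X Y : P -> nat) (H : nat) :
  trapezoid_chart rho X Y H -> max_rank rho = H.
Proof.
move=> ch; apply/eqP; rewrite eqn_leq; apply/andP; split.
  by apply/bigmax_leqP => a _; rewrite -(chart_rank ch a) leq_addr.
have [//|top [X0 Y0]] := chart_onto ch (leqnn 0).
rewrite -(chart_rank ch top) X0 Y0 !addn0.
exact: (leq_bigmax top).
Qed.

Lemma qzeta_A_cone (d : Order.disp_t) (P : finPOrderType d)
    (rho X Y : P -> nat) (H : nat) :
  trapezoid_chart rho X Y H ->
  forall m, qzeta_A rho m = zeta_cone rho X Y m 0 0.
Proof.
move=> ch m.
have below a : \sum_(s : m.-tuple P | path >=%O a s)
    \prod_(b <- s) 'X^(rho b) = zeta_cone rho X Y m (X a) (Y a).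
  elim: m a => [|m IHm] a /=.
    rewrite (eq_bigl (pred1 [tuple])); last by move=> t; rewrite tuple0.
    by rewrite big_pred1_eq big_nil.
  rewrite (big_tuple_cons _ _ (path >=%O a)
    (fun s => \prod_(b <- s) 'X^(rho b))).
  rewrite [RHS]big_mkcond; apply: eq_bigr => b _; rewrite -(chart_le ch) /=.
  case: ifP => _; last by rewrite big_pred0.
  by rewrite -IHm big_distrr; apply: eq_bigr => s _; rewrite big_cons.
have [//|top [X0 Y0]] := chart_onto ch (leqnn 0).
have := below top; rewrite X0 Y0 => <-; rewrite /qzeta_A.
transitivity (\sum_(x : m.-tuple P | sorted <=%O x)
  \prod_(b <- x) ('X^(rho b) : {poly int})).
  by apply: eq_bigr => x _; rewrite big_tuple prodrXr.
(* A reversed multichain is decreasing, and it can always be continued upwards by [top]. *)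
rewrite (big_tuple_rev _ _ (sorted <=%O) (fun s => \prod_(b <- s) 'X^(rho b))).
apply: eq_big => [x|x _]; last by rewrite (perm_big _ (permEl (perm_rev _))).
rewrite rev_sorted; case: x => -[|b s] //= _.
by rewrite (chart_le ch) X0 Y0.
Qed.

Lemma zeta_cone_outside (d : Order.disp_t) (P : finPOrderType d)
    (rho X Y : P -> nat) (H x y : nat) :
  trapezoid_chart rho X Y H -> (H < x + y)%N ->
  forall m, zeta_cone rho X Y m x y = (m == 0%N)%:R.
Proof.
move=> ch ltH [|m] //=; rewrite big_pred0 // => a.
have := chart_rank ch a; lia.
Qed.

(** Since [X a <= Y a], the bound [x < X a] already forces [x < Y a]. *)
Lemma zeta_cone_diag (d : Order.disp_t) (P : finPOrderType d)
    (rho X Y : P -> nat) (H x : nat) :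
  trapezoid_chart rho X Y H ->
  forall m, zeta_cone rho X Y m x.+1 x = zeta_cone rho X Y m x.+1 x.+1.
Proof.
move=> ch [|m] //=; apply: eq_bigl => a.
have := chart_leXY ch a; lia.
Qed.

Lemma zeta_coneS (d : Order.disp_t) (P : finPOrderType d)
    (rho X Y : P -> nat) (H h x y : nat) :
  trapezoid_chart rho X Y H -> (x <= y)%N -> (h + (x + y) = H)%N ->
  forall m, zeta_cone rho X Y m.+1 x.+1 y + zeta_cone rho X Y m.+1 x y.+1
            - zeta_cone rho X Y m.+1 x.+1 y.+1
    = zeta_cone rho X Y m.+1 x y - 'X^h * zeta_cone rho X Y m x y.
Proof.
move=> ch lexy Hh m; pose F a := 'X^(rho a) * zeta_cone rho X Y m (X a) (Y a).
have coneE u v : zeta_cone rho X Y m.+1 u v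
    = \sum_(b | (u <= X b)%N && (v <= Y b)%N) F b by [].
rewrite !coneE.
have [|a [Xa Ya]] := chart_onto ch lexy; first by rewrite -Hh leq_addl.
have -> : 'X^h * zeta_cone rho X Y m x y
          = \sum_(b | (X b == x) && (Y b == y)) F b.
  rewrite (big_pred1 a) => [|b] /=.
    congr ('X^ _ * _); last by rewrite Xa Ya.
    by have := chart_rank ch a; lia.
  apply/andP/eqP => [[/eqP Xb /eqP Yb]|->]; last by rewrite Xa Ya !eqxx.
  by apply/le_anti; rewrite !(chart_le ch) Xa Ya Xb Yb !leqnn.
rewrite big_mkcond [X in _ + X - _]big_mkcond [X in _ - X = _]big_mkcond.
rewrite [X in _ = X - _]big_mkcond [X in _ = _ - X]big_mkcond.
rewrite -big_split -!sumrB; apply: eq_bigr => b _ /=.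
by case: (ltngtP x (X b)) => _; case: (ltngtP y (Y b)) => _ /=; ring.
Qed.

(** Here [h] is the rank of (x, y) plus one, so [h = 0] is the line just outside the trapezoid. The
    induction is strong because (x+1, y+1) lies two ranks lower. *)
Lemma clears_zeta_cone (d : Order.disp_t) (P : finPOrderType d)
    (rho X Y : P -> nat) (H : nat) :
  trapezoid_chart rho X Y H ->
  forall h x y, (x <= y)%N -> (h + (x + y) = H.+1)%N ->
  clears (fun m => zeta_cone rho X Y m x y)
    (\prod_(a < h) (1 - ('X^a)%:P * 'X)) (ballot_sum_pred h (y - x)).
Proof.
move=> ch; elim/ltn_ind => -[_|h IHh] x y lexy Hh.
  rewrite big_ord0; apply: eq_clears (clears1 _) => m.
  by rewrite (zeta_cone_outside ch) //; lia.
rewrite big_ord_recr /=.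
apply: (clearsMl (v := fun m => zeta_cone rho X Y m x.+1 y
  + zeta_cone rho X Y m x y.+1 - zeta_cone rho X Y m x.+1 y.+1)).
- by rewrite addrK.
- by move=> m; apply: (zeta_coneS ch) => //; lia.
(* At rank 0 all three neighbours lie outside. *)
case: h IHh Hh => [|h] IHh Hh.
  rewrite big_ord0 ballot_sum0; apply: eq_clears (clears1 _) => m.
  by rewrite !(zeta_cone_outside ch) ?addrK //; lia.
have Ry : clears (fun m => zeta_cone rho X Y m x y.+1)
    (\prod_(a < h.+1) (1 - ('X^a)%:P * 'X)) (ballot_sum_pred h.+1 (y - x).+1).
  by rewrite -subSn //; apply: IHh; lia.
(* On the diagonal the two terms at x+1 cancel; correspondingly no word there can end in L. *)
have [ltxy|geyx] := ltnP x y; last first.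
  have yx : y = x by apply/eqP; rewrite eqn_leq geyx.
  rewrite {}yx subnn /= in Ry *; rewrite ballot_sumS0.
  apply: eq_clears Ry => m.
  by rewrite (zeta_cone_diag _ ch) addrAC subrr add0r; congr zeta_cone; lia.
have [k kE] : exists k, (y - x = k.+1)%N by exists (y - x).-1; lia.
rewrite kE ballot_sumSS; rewrite kE in Ry.
apply: clearsB; last first.
  (* The denominator at (x+1, y+1) has one factor fewer, and the missing [1 - q^h t] is the one in
     [ballot_sumSS]. *)
  rewrite big_ord_recr; apply: clearsMr.
  by rewrite -kE -(subSS x); apply: IHh; lia.
apply: clearsD => //.
have -> : ballot_sum h k = ballot_sum_pred h.+1 (y - x.+1).
  by rewrite /=; congr ballot_sum; lia.
by apply: IHh; lia.
Qed.

(** * The positive roots of type B as a trapezoid *)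

(* [ext_coord r k], for [0 <= k <= 2 r], runs through
   e_0, ..., e_(r-1), 0, -e_(r-1), ..., -e_0. *)
Definition ext_coord (r k : nat) : 'rV[int]_r :=
  \row_j ((j == k :> nat)%:R - (j + k == 2 * r)%N%:R).

Definition trapezoid_root (r x y : nat) : 'rV[int]_r :=
  ext_coord r x + ext_coord r y.+1.

Lemma ext_coord_stdvec (r : nat) (i : 'I_r) : ext_coord r i = stdvec i.
Proof.
apply/rowP => j; rewrite !mxE eqxx /= -val_eqE /=.
have -> : (j + i == 2 * r)%N = false.
  by have := ltn_ord i; have := ltn_ord j; lia.
by rewrite subr0.
Qed.

Lemma ext_coord_mid (r : nat) : ext_coord r r = 0.
Proof.
apply/rowP => j; rewrite !mxE; have := ltn_ord j => ltj.
have -> : (j + r == 2 * r)%N = false by lia.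
by rewrite (ltn_eqF ltj) subrr.
Qed.

Lemma ext_coord_rev (r k : nat) :
  (k <= 2 * r)%N -> ext_coord r (2 * r - k) = - ext_coord r k.
Proof.
move=> lek; apply/rowP => j; rewrite !mxE opprB.
by congr (_%:R - _%:R); congr nat_of_bool; lia.
Qed.

Lemma height_ext_coord (r k : nat) :
  (k <= 2 * r)%N -> height (ext_coord r k) = r%:Z - k%:Z.
Proof.
have small j : (j <= r)%N -> height (ext_coord r j) = r%:Z - j%:Z.
  rewrite leq_eqVlt => /predU1P[->|ltj].
    by rewrite ext_coord_mid -[0](subrr (0 : 'rV_r)) heightD heightN !subrr.
  by rewrite (ext_coord_stdvec (Ordinal ltj)) height_stdvec /=; lia.
move=> lek; have [/small //|ltrk] := leqP k r.
rewrite -[k in LHS](subKn lek) ext_coord_rev ?leq_subr // heightN small; lia.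
Qed.

(** The cases [y.+1 < r], [y.+1 = r] and [y.+1 > r] give [e_i + e_j], [e_i] and [e_i - e_j]. In the
    last one [j = 2r - y - 1], and the bound on [x + y] says [i < j]. *)
Lemma mem_positive_roots (r : nat) (v : 'rV[int]_r) :
  reflect (exists x y, [/\ (x <= y)%N, (x + y <= 2 * r - 2)%N, (0 < r)%N
                         & v = trapezoid_root r x y])
          (v \in positive_roots r).
Proof.
rewrite /positive_roots !mem_cat; apply: (iffP or3P).
- case=> /mapP[].
  + case=> i j; rewrite mem_filter /= => /andP[ltij _] ->.
    have := ltn_ord j => ltj; exists i, (2 * r - j).-1; split; try lia.
    rewrite /trapezoid_root prednK; last lia.
    by rewrite ext_coord_rev ?ext_coord_stdvec //; lia.
  + move=> i _ ->; have := ltn_ord i => lti; exists i, r.-1; split; try lia.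
    rewrite /trapezoid_root prednK; last lia.
    by rewrite ext_coord_mid addr0 ext_coord_stdvec.
  + case=> i j; rewrite mem_filter /= => /andP[ltij _] ->.
    have := ltn_ord j => ltj; exists i, j.-1; split; try lia.
    rewrite /trapezoid_root prednK; last lia.
    by rewrite !ext_coord_stdvec.
- case=> x [y [lexy lexyr r_gt0 ->]].
  have ltx : (x < r)%N by lia.
  rewrite /trapezoid_root (ext_coord_stdvec (Ordinal ltx)).
  have [lty|lty|->] := ltngtP y.+1 r.
  + apply: Or33; apply/mapP; exists (Ordinal ltx, Ordinal lty).
      by rewrite mem_filter mem_enum /= ltnS lexy.
    by rewrite -(ext_coord_stdvec (Ordinal lty)).
  + have lty' : (2 * r - y.+1 < r)%N by lia.
    apply: Or31; apply/mapP; exists (Ordinal ltx, Ordinal lty').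
      by rewrite mem_filter mem_enum /= andbT; lia.
    rewrite /= -(ext_coord_stdvec (Ordinal lty')) /= ext_coord_rev ?opprK //.
    by lia.
  + apply: Or32; apply/mapP; exists (Ordinal ltx); first by rewrite mem_enum.
    by rewrite ext_coord_mid addr0.
Qed.

(* The coefficient of alpha_i, as alpha_j = e_j - e_(j+1) telescopes. *)
Definition partial_sum (r : nat) (i : 'I_r) (v : 'rV[int]_r) : int :=
  \sum_(j < r | (j <= i)%N) v 0 j.

Lemma sum_delta_le (r k : nat) (i : 'I_r) :
  \sum_(j < r | (j <= i)%N) (j == k :> nat)%:R = (k <= i)%N%:R :> int.
Proof.
have [leki|ltik] := leqP k i; last first.
  by rewrite big1 // => j leji; case: eqP => // Ej; lia.
rewrite (bigD1 (Ordinal (leq_ltn_trans leki (ltn_ord i)))) //= eqxx.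
by rewrite big1 ?addr0 // => j /andP[_ /negPf]; rewrite -val_eqE /= => ->.
Qed.

Lemma partial_sum_comb (r : nat) (i : 'I_r) (c : 'I_r -> int) :
  partial_sum i (\sum_k c k *: simple_root k) = c i.
Proof.
transitivity (\sum_k c k * ((k <= i)%N%:R - (k < i)%N%:R)).
  rewrite /partial_sum; under eq_bigr do rewrite summxE.
  rewrite exchange_big; apply: eq_bigr => k _.
  under eq_bigr do rewrite mxE simple_rootE.
  by rewrite -big_distrr sumrB -!sum_delta_le.
rewrite (bigD1 i) //= leqnn ltnn subr0 mulr1 big1 ?addr0 // => k.
by rewrite -val_eqE /= neq_ltn => /orP[]; case: ltngtP => // _ _;
  rewrite subrr mulr0.
Qed.

Lemma rootB_le_partial_sum (r : nat) (a b : posrootB r) :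
  (a <= b)%O <-> forall i, partial_sum i (val a) <= partial_sum i (val b).
Proof.
have psumE v i : partial_sum i v = simple_coeffs v 0 i.
  by rewrite {1}(simple_coeffsP v) partial_sum_comb.
have psumB i : partial_sum i (val b - val a)
    = partial_sum i (val b) - partial_sum i (val a).
  by rewrite !psumE /simple_coeffs mulmxBl !mxE.
split=> [/rootB_leP[c Ec] i|leab].
  rewrite -subr_ge0 -psumB Ec.
  under [X in partial_sum i X]eq_bigr do rewrite -scaler_nat.
  by rewrite partial_sum_comb ler0n.
apply/rootB_leP; exists (fun i => `|partial_sum i (val b - val a)|%N).
rewrite {1}(simple_coeffsP (val b - val a)); apply: eq_bigr => i _.
by rewrite -scaler_nat -psumE natz gez0_abs // psumB subr_ge0.
Qed.

Lemma partial_sum_ext_coord (r k : nat) (i : 'I_r) : (k <= 2 * r)%N ->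
  partial_sum i (ext_coord r k) = (k <= i)%N%:R - (2 * r - k <= i)%N%:R.
Proof.
move=> lek; rewrite /partial_sum; under eq_bigr do rewrite mxE.
rewrite sumrB -!sum_delta_le; congr (_ - _); apply: eq_bigr => j _.
by congr (nat_of_bool _)%:R; lia.
Qed.

Lemma partial_sum_trapezoid_root (r x y : nat) (i : 'I_r) :
  (x <= y)%N -> (x + y <= 2 * r - 2)%N ->
  partial_sum i (trapezoid_root r x y) =
  (x <= i)%N%:R + (y < i)%N%:R - (2 * r - y.+1 <= i)%N%:R.
Proof.
have lti := ltn_ord i => lexy lexyr.
have -> : partial_sum i (trapezoid_root r x y)
    = partial_sum i (ext_coord r x) + partial_sum i (ext_coord r y.+1).
  by rewrite -big_split; apply: eq_bigr => j _; rewrite mxE.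
by rewrite !partial_sum_ext_coord; lia.
Qed.

Lemma le_trapezoid_root (r x y x' y' : nat) :
  (0 < r)%N ->
  (x <= y)%N -> (x + y <= 2 * r - 2)%N ->
  (x' <= y')%N -> (x' + y' <= 2 * r - 2)%N ->
  (forall i : 'I_r, partial_sum i (trapezoid_root r x y)
                    <= partial_sum i (trapezoid_root r x' y'))
  <-> (x' <= x)%N && (y' <= y)%N.
Proof.
move=> r_gt0 lexy lexyr lexy' lexyr'.
have psum := partial_sum_trapezoid_root.
split=> [le_psum|/andP[lex ley] i]; last by rewrite !psum //; lia.
(* Each failing inequality is detected at one index: [x], where the coefficients of the first root
   become 1; [y.+1], where they become 2; or [2r - 2 - y], the last index before they drop back to
   0. *)
apply/andP; split; rewrite leqNgt; apply/negP => lt.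
  have ltx : (x < r)%N by lia.
  by have := le_psum (Ordinal ltx); rewrite !psum //=; lia.
have [lty|gey] := ltnP y.+1 r.
  by have := le_psum (Ordinal lty); rewrite !psum //=; lia.
have ltt : (2 * r - 2 - y < r)%N by lia.
by have := le_psum (Ordinal ltt); rewrite !psum //=; lia.
Qed.

Lemma rootB_chart (r : nat) : (0 < r)%N ->
  exists X Y, trapezoid_chart (@rootB_rank r) X Y (2 * r - 2).
Proof.
move=> r_gt0.
have /choice[XY XYP] : forall a : posrootB r, exists xy : nat * nat,
    [/\ (xy.1 <= xy.2)%N, (xy.1 + xy.2 <= 2 * r - 2)%N
      & val a = trapezoid_root r xy.1 xy.2].
  move=> a; have /mem_positive_roots[x [y [? ? _ ?]]] := valP a.
  by exists (x, y).
have le_XY a b : (a <= b)%O =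
    ((XY b).1 <= (XY a).1)%N && ((XY b).2 <= (XY a).2)%N.
  have [lea lear Ea] := XYP a; have [leb lebr Eb] := XYP b.
  have := le_trapezoid_root r_gt0 lea lear leb lebr.
  rewrite -Ea -Eb => -[leE Ele].
  by apply/idP/idP => [/rootB_le_partial_sum/leE|/Ele/rootB_le_partial_sum].
exists (fun a => (XY a).1), (fun a => (XY a).2).
split=> // [a|a|x y lexy lexyr].
- by have [] := XYP a.
- have [? ? Ea] := XYP a; have := rootB_rankE a.
  rewrite Ea heightD !height_ext_coord; lia.
- have rootP : trapezoid_root r x y \in positive_roots r.
    by apply/mem_positive_roots; exists x, y.
  exists (SeqSub rootP); have [lea lear /= Ea] := XYP (SeqSub rootP).
  (* The coordinates picked by [choice] for this root are (x, y) themselves: equal roots have equal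
     partial sums, which bounds each pair by the other. *)
  have [le1 _] := le_trapezoid_root r_gt0 lexy lexyr lea lear.
  have [le2 _] := le_trapezoid_root r_gt0 lea lear lexy lexyr.
  rewrite -{}Ea in le1 le2.
  by have /andP[] := le1 (fun=> lexx _);
    have /andP[] := le2 (fun=> lexx _); lia.
Qed.

(** * Identification of the numerator and positivity *)

Lemma ballotB_sum (r : nat) :
  \sum_(w in ballotB r)
     ('X^(\sum_(j <- wordD w) (j - 1)))%:P * 'X^(size (wordD w))
  = ballot_sum (2 * r - 2) 0 :> {poly {poly int}}.
Proof.
rewrite (eq_bigl (fun w : _.-tuple _ => ballot_from 0 (rev w))); last first.
  by move=> w; rewrite inE ballotE.
rewrite (big_tuple_rev _ _ (fun w => ballot_from 0 (rev w)) word_weight).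
by apply: eq_bigl => w; rewrite revK.
Qed.

Lemma ballot_sum_coef_ge0 (h d i j : nat) : 0 <= ((ballot_sum h d)`_i)`_j.
Proof.
rewrite /ballot_sum !coef_sum; apply: sumr_ge0 => s _.
rewrite /word_weight coefCM coefXn; case: eqP => _; last by rewrite mulr0 coef0.
by rewrite mulr1 coefXn ler0n.
Qed.

Theorem theorem1p1 (r : nat) (hr : (1 <= r)%N) :
  (exists! N : {poly {poly int}}, is_qzeta_numerator (@rootB_rank r) N) /\
  (forall N : {poly {poly int}}, is_qzeta_numerator (@rootB_rank r) N ->
     N = \sum_(w in ballotB r)
           ('X^(\sum_(j <- wordD w) (j - 1)))%:P * 'X^(size (wordD w)) /\
     (forall i j : nat, 0 <= (N`_i)`_j)).
Proof.
have [X [Y ch]] := rootB_chart hr.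
have numP : is_qzeta_numerator (@rootB_rank r) (ballot_sum (2 * r - 2) 0).
  rewrite /is_qzeta_numerator /qzeta_denominator (max_rank_chart ch).
  have := clears_zeta_cone ch (leqnn 0) (addn0 _).
  by apply: eq_clears => m; rewrite (qzeta_A_cone ch).
have num_eq N : is_qzeta_numerator (@rootB_rank r) N ->
    N = ballot_sum (2 * r - 2) 0.
  by move=> NP; apply/polyP => n; rewrite -NP numP.
split; first by exists (ballot_sum (2 * r - 2) 0); split=> // N /num_eq.
move=> N /num_eq ->; split; first by rewrite ballotB_sum.
by move=> i j; apply: ballot_sum_coef_ge0.
Qed.
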